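(* Let $\mu^*$ be an upward continuous outer measure on a set $X$. Then $\mathrm{GES}(X,\mu^* )$ holds if and only if for every function $\varphi:X\to\mathbb{N}^{\mathbb{N}}$ there is a subset $Y\subseteq X$ with $\mu^*(Y)=\mu^*(X)$ such that $\varphi[Y]\in\mathcal{K}_\sigma$.
   Context: An outer measure on $X$ is a map $\mu^*:\mathcal{P}(X)\to[0,+\infty]$ with $\mu^*(\emptyset)=0$, monotone and countably subadditive; it is upward continuous if whenever $A=\bigcup_{n\in\mathbb{N}}A_n$ we have $\mu^*(A)=\lim_{n\to\infty}\mu^*(\bigcup_{k<n}A_k)$. $\mathrm{GES}(X,\mu^* )$ is the statement: for every sequence $(F_l)_{l\in\mathbb{N}}$ of functions $X\to\mathbb{R}$ converging pointwise to $0$ and every real $M<\mu^*(X)$ there is $A\subseteq X$ with $\mu^*(A)>M$ such that $(F_l)$ converges uniformly on $A$. $\mathcal{K}_\sigma$ is the $\sigma$-ideal of subsets of $\mathbb{N}^{\mathbb{N}}$ generated by the sets bounded in the everywhere-domination order ($\alpha\le\beta$ iff $\alpha_n\le\beta_n$ for all $n$); equivalently, the sets $B\subseteq\mathbb{N}^{\mathbb{N}}$ for which some $\beta$ eventually dominates every element of $B$. *)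

(* Defs.v *)
From HB Require Import structures.
From mathcomp Require Import all_boot all_order all_algebra.
From mathcomp Require Import all_classical all_reals all_analysis.
Set Implicit Arguments.
Unset Strict Implicit.
Unset Printing Implicit Defensive.
Import Order.TTheory GRing.Theory Num.Theory.
Import numFieldNormedType.Exports.
Local Open Scope classical_set_scope.
Local Open Scope ring_scope.

Definition upward_continuous (R : realType) (X : Type)
    (mu : set X -> \bar R) : Prop :=
  forall A : nat -> set X,
    (fun n => mu (\bigcup_(k < n) A k)) @ \oo --> mu (\bigcup_k A k).

(* The uniform convergence structure on functions is only available over a
   choiceType; [{classic X}] is [X] itself with its classical choice structure,
   so that no structure on [X] has to be assumed. *)
Definition GES (R : realType) (X : Type) (mu : set X -> \bar R) : Prop :=
  forall F : nat -> X -> R,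
    (forall x : X, F l x @[l --> \oo] --> (0 : R)) ->
    forall M : R, (M%:E < mu [set: X])%E ->
    exists A : set X,
      (M%:E < mu A)%E /\
      {uniform (A : set {classic X}),
        (F : nat -> {classic X} -> R) @ \oo --> (cst 0 : {classic X} -> R)}.

Definition sigma_ideal (T : Type) (I : set (set T)) : Prop :=
  [/\ I set0,
      forall A B : set T, A `<=` B -> I B -> I A &
      forall A : nat -> set T, (forall n, I (A n)) -> I (\bigcup_n A n)].

Definition dominated (B : set (nat -> nat)) : Prop :=
  exists beta : nat -> nat,
    forall alpha, B alpha -> forall n, (alpha n <= beta n)%N.

Definition K_sigma : set (set (nat -> nat)) :=
  smallest (@sigma_ideal (nat -> nat)) dominated.

(* Main.v *)
(** A function [X -> nat -> nat] and a sequence of functions tending to [0]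
    pointwise encode each other: [phi x n] plays the role of a rank from which
    on [`|F l x| < 1 / (n + 1)].  Under this correspondence uniform convergence on
    [A] is domination of [phi @` A].  Exhausting [mu setT] by countably many
    sets of uniform convergence gives a set of full measure with image in
    [K_sigma]; conversely an eventually dominated image is an increasing union
    of dominated pieces, one of which is large enough by upward continuity. *)
Require Import Defs.
From HB Require Import structures.
From mathcomp Require Import all_boot all_order all_algebra.
From mathcomp Require Import all_classical all_reals all_analysis.
Import Order.TTheory GRing.Theory Num.Theory.
Import numFieldNormedType.Exports.
Local Open Scope classical_set_scope.
Local Open Scope ring_scope.
Set Implicit Arguments.
Unset Strict Implicit.

Lemma uniform_cvg0P (R : realType) (U : choiceType) (A : set U)
    (f : nat -> U -> R) :
  {uniform A, f @ \oo --> (cst 0 : U -> R)} <->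
  forall e, 0 < e -> exists N, forall l x, (N <= l)%N -> A x -> `|f l x| < e.
Proof.
split=> [cvf e e0|H P /uniform_nbhs[E [entE EP]]].
  have /cvf[N _ NA] : nbhs ((cst 0 : U -> R) : {uniform` A -> R})
      [set h | forall y, A y -> `|h y| < e].
    apply/uniform_nbhs; exists [set xy | ball xy.1 e xy.2]; split.
      exact: (entourage_ball _ (PosNum e0)).
    by move=> h /= hE y /hE; rewrite /ball /= sub0r normrN.
  by exists N => l x Nl Ax; exact: NA.
move: entE; rewrite -entourage_ballE => -[e /= e0 eE].
have [N NA] := H e e0.
exists N => // l Nl; apply: EP => y Ay; apply: eE.
by rewrite /= /ball /= sub0r normrN; exact: NA.
Qed.

Lemma K_sigma_bigcup (B : nat -> set (nat -> nat)) :
  (forall k, dominated (B k)) -> K_sigma (\bigcup_k B k).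
Proof.
move=> domB I [[_ _ +] domI]; apply=> k; exact/domI/domB.
Qed.

(** Eventually dominated sets form a sigma-ideal containing the dominated ones, so minimality of
    [K_sigma] gives the inclusion. *)
Lemma K_sigma_eventually_dominated (B : set (nat -> nat)) : K_sigma B ->
  exists beta : nat -> nat,
    forall alpha, B alpha -> \forall n \near \oo, (alpha n <= beta n)%N.
Proof.
move: B; apply: (@smallest_sub _ _ _ [set B | exists beta : nat -> nat,
  forall alpha, B alpha -> \forall n \near \oo, (alpha n <= beta n)%N])
  => [|B [beta betaP]]; last first.
  by exists beta => alpha /betaP aP; exact: nearW.
split=> [|A B AB [beta betaP]|A /choice[beta betaP]].
- by exists (fun=> 0%N).
- by exists beta => alpha /AB; exact: betaP.
(* Diagonal bound: it lies above [beta k] at every [n >= k]. *)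
exists (fun n => \max_(k < n.+1) beta k n)%N => alpha [k _ /betaP aP].
near=> n; apply: leq_trans (_ : beta k n <= _)%N; first by near: n.
have kn : (k < n.+1)%N by near: n; exact: nbhs_infty_ge.
exact: (leq_bigmax (Ordinal kn)).
Unshelve. all: by end_near. Qed.

Section escape_time.
Variable alpha : nat -> nat.

(** Searching only below [l] makes the failure value of [find] equal to [l], so the result still
    tends to infinity when [alpha] stays below [l] there. *)
Definition escape_time (l : nat) : nat :=
  find (fun n => l <= alpha n)%N (iota 0 l).

Lemma escape_time_gt n l : (n < l)%N -> (n < escape_time l)%N ->
  (alpha n < l)%N.
Proof.
move=> nl /(before_find 0%N).
by rewrite nth_iota // add0n leqNgt => /negbFE.
Qed.

(** An escape before [N] forces [l] to be at most the maximum of [alpha] on the indices below [N],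
    which fails for large [l]. *)
Lemma escape_time_cvg N : \forall l \near \oo, (N <= escape_time l)%N.
Proof.
near=> l; rewrite leqNgt; apply/negP => eN.
have Nl : (N <= l)%N by near: l; exact: nbhs_infty_ge.
have el : (escape_time l < l)%N by exact: leq_trans eN Nl.
have := el; rewrite -{2}(size_iota 0 l) -has_find => /(nth_find 0%N).
rewrite -/(escape_time l) nth_iota // add0n leqNgt => /negP; apply.
apply: (@leq_ltn_trans (\max_(n < N) alpha n)%N).
  exact: (leq_bigmax (Ordinal eN)).
by near: l; exact: nbhs_infty_gt.
Unshelve. all: by end_near. Qed.

End escape_time.

Section egorov.
Context (R : realType) (X : Type).
Implicit Types (F : nat -> X -> R) (phi : X -> nat -> nat).

(** The test sequence to which [GES] is applied: a value below [1 / (n + 1)] at some [l > n] forces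
    [phi x n < l]. *)
Definition escape_rate phi (l : nat) (x : X) : R :=
  (escape_time (phi x) l).+1%:R^-1.

Lemma escape_rate_cvg0 phi x : escape_rate phi l x @[l --> \oo] --> (0 : R).
Proof.
apply/cvgr0Pnorm_lt => e e0.
have [N _ /(_ N (leqnn N)) Ne] := near_infty_natSinv_lt (PosNum e0).
apply: filterS (escape_time_cvg (phi x) N) => l Nl.
rewrite /escape_rate ger0_norm ?invr_ge0//; apply: le_lt_trans Ne.
by rewrite lef_pV2 ?posrE// ler_nat.
Qed.

Lemma escape_rate_dominated phi (A : set X) :
  {uniform (A : set {classic X}),
    (escape_rate phi : nat -> {classic X} -> R) @ \oo
      --> (cst 0 : {classic X} -> R)} ->
  dominated (phi @` A).
Proof.
move=> /uniform_cvg0P H.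
have /choice[N NP] n : exists N, forall l x, (N <= l)%N -> A x ->
    (n < escape_time (phi x) l)%N.
  have [|N NP] := H n.+1%:R^-1; first by rewrite invr_gt0.
  exists N => l x Nl Ax; have := NP l x Nl Ax.
  rewrite /escape_rate ger0_norm ?invr_ge0//.
  by rewrite ltf_pV2 ?posrE// ltr_nat.
(* The term [n.+1] places [n] inside the search range of [escape_time]. *)
exists (fun n => maxn (N n) n.+1) => _ [x Ax <-] n.
apply/ltnW/escape_time_gt; first exact: leq_maxr.
by apply: NP => //; exact: leq_maxl.
Qed.

Definition rank_sequence F phi :=
  forall x n l, (phi x n <= l)%N -> `|F l x| < n.+1%:R^-1.

Lemma exists_rank_sequence F : (forall x, F l x @[l --> \oo] --> (0 : R)) ->
  exists phi, rank_sequence F phi.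
Proof.
move=> F0.
have /choice[phi phiP] (xn : X * nat) : exists N,
    forall l, (N <= l)%N -> `|F l xn.1| < xn.2.+1%:R^-1.
  have /cvgr0Pnorm_lt/(_ xn.2.+1%:R^-1) := F0 xn.1.
  by rewrite invr_gt0 ltr0n => /(_ isT)[N _ NP]; exists N.
by exists (fun x n => phi (x, n)) => x n; exact: (phiP (x, n)).
Qed.

Lemma rank_sequence_uniform F phi (A : set X) (beta : nat -> nat) m :
  rank_sequence F phi ->
  (forall x n, A x -> (m <= n)%N -> (phi x n <= beta n)%N) ->
  {uniform (A : set {classic X}),
    (F : nat -> {classic X} -> R) @ \oo --> (cst 0 : {classic X} -> R)}.
Proof.
move=> Fphi Abeta; apply/uniform_cvg0P => e e0.
have [N _ NP] := near_infty_natSinv_lt (PosNum e0).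
(* The index [maxn m N] is late enough both for [beta] to bound the ranks and for [1 / (index + 1)]
   to be below [e]. *)
exists (beta (maxn m N)) => l x betal Ax.
apply: lt_trans (NP (maxn m N) _); last exact: leq_maxr.
by apply/Fphi/(leq_trans _ betal)/Abeta => //; exact: leq_maxl.
Qed.

(** [GES] accepts only real levels strictly below the total mass; countably many of them recover
    that mass, even when it is infinite. *)
Lemma exists_seq_approx (y : \bar R) : (0 <= y)%E ->
  exists M : nat -> R, (forall k, (M k)%:E < y)%E /\
    forall z, (forall k, (M k)%:E < z)%E -> (y <= z)%E.
Proof.
case: y => [r _|_|//].
  exists (fun k => r - k.+1%:R^-1); split=> [k|z zP].
    by rewrite lte_fin ltrBlDr ltrDl invr_gt0.
  apply/lee_subgt0Pr => e e0.
  have [N _ /(_ N (leqnn N)) Ne] := near_infty_natSinv_lt (PosNum e0).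
  by apply: le_trans (ltW (zP N)); rewrite -EFinB lee_fin lerB// ltW.
exists (fun k => k%:R); split=> [k|z zP]; first exact: ltry.
rewrite leye_eq; apply/eqP/eqyP => A A0.
have [N _ /(_ N (leqnn N)) NA] := nbhs_infty_ger A.
by apply: le_trans (ltW (zP N)); rewrite lee_fin.
Qed.

Lemma GES_K_sigma (mu : {outer_measure set X -> \bar R}) : GES mu ->
  forall phi, exists Y : set X, mu Y = mu [set: X] /\ K_sigma (phi @` Y).
Proof.
move=> ges phi.
have [M [Mlt Mapprox]] := exists_seq_approx (outer_measure_ge0 mu [set: X]).
have /choice[A AP] k := ges _ (escape_rate_cvg0 phi) (M k) (Mlt k).
exists (\bigcup_k A k); split; last first.
  rewrite image_bigcup; apply: K_sigma_bigcup => k.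
  by apply: escape_rate_dominated; have [] := AP k.
apply/eqP; rewrite eq_le le_outer_measure//=.
apply: Mapprox => k; apply: lt_le_trans (proj1 (AP k)) _.
exact/le_outer_measure/bigcup_sup.
Qed.

Lemma K_sigma_GES (mu : {outer_measure set X -> \bar R}) :
  upward_continuous mu ->
  (forall phi, exists Y : set X,
    mu Y = mu [set: X] /\ K_sigma (phi @` Y)) -> GES mu.
Proof.
move=> muc H F /exists_rank_sequence[phi Fphi] M MX.
have [Y [muY /K_sigma_eventually_dominated[beta betaP]]] := H phi.
pose Z m := [set x | Y x /\ forall n, (m <= n)%N -> (phi x n <= beta n)%N].
have YZ : Y = \bigcup_m Z m.
  apply/seteqP; split=> [x Yx|x [m _ []]//].
  by have [m _ mP] := betaP _ (imageP phi Yx); exists m.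
have : (M%:E < mu (\bigcup_m Z m))%E by rewrite -YZ muY.
(* The values above [M] form a neighbourhood of the limit, so some finite union of the [Z k] already
   has measure above [M]. *)
move=> /open_ereal_gt' /(muc Z)[N _ /(_ N (leqnn N)) /= MZ].
exists (\bigcup_(k < N) Z k); split=> //.
(* Every [k < N] has its bound valid from [N] on, so [N] is a common cutoff. *)
apply: (@rank_sequence_uniform _ phi _ beta N) => // x n [k /= kN [_ Zx]] Nn.
exact/Zx/(leq_trans _ Nn)/ltnW.
Qed.

End egorov.

Theorem theorem5 (R : realType) (X : Type) (mu : {outer_measure set X -> \bar R})
    (mu_upward : upward_continuous mu) :
  GES mu <->
  forall phi : X -> (nat -> nat),
    exists Y : set X, mu Y = mu [set: X] /\ K_sigma (phi @` Y).
Proof.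
by split=> [|H]; [exact: GES_K_sigma|exact: K_sigma_GES].
Qed.
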